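(* For every integer $s$ there is a constant $c=c(s)$ such that for all integers $k\ge 3$ and all $n\ge 2$, $r_k(K_s,P_n) \le {\rm twr}_{k-2}\left(2^{c(\log n)^{s-1}}\right)$.
   Context: For ordered $k$-uniform hypergraphs $G,H$, the ordered Ramsey number $r_k(G,H)$ is the minimum $N$ such that every red/blue coloring of the $k$-element subsets of $[N]=\{1,\dots,N\}$ contains a red copy of $G$ or a blue copy of $H$, where copies are order-preserving embeddings. $K_s=K_s^{(k)}$ is the complete $k$-uniform hypergraph on $s$ vertices. The monotone path $P_n=P_n^{(k)}$ is the ordered $k$-uniform hypergraph on $\{1,\dots,n\}$ with the $n-k+1$ edges $\{i,i+1,\dots,i+k-1\}$, $i=1,\dots,n-k+1$. The tower function is defined by ${\rm twr}_1(x)=x$ and ${\rm twr}_{i+1}(x)=2^{{\rm twr}_i(x)}$. Logarithms are base $2$. *)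

(* Defs.v *)
From mathcomp Require Import all_boot all_order all_algebra.
From mathcomp Require Import all_classical all_reals all_analysis.

Set Implicit Arguments.
Unset Strict Implicit.
Unset Printing Implicit Defensive.

Import Order.TTheory GRing.Theory Num.Theory.
Local Open Scope ring_scope.

(* The vertex set {1, ..., m} is represented by 'I_m = {0, ..., m - 1} with its
   natural order. *)
Record ordered_hypergraph (k : nat) := OrderedHypergraph {
  nb_vertices : nat;
  edges : {set {set 'I_nb_vertices}};
  edges_uniform : forall e, e \in edges -> #|e| = k
}.

(* A red/blue coloring of the k-subsets of [N] is represented by a function
   chi on all subsets; only its values on k-subsets are ever used, since
   embeddings are injective and the edges of G have size k. *)
Definition mono_copy (k N : nat) (G : ordered_hypergraph k)
    (chi : {set 'I_N} -> bool) (color : bool) : Prop :=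
  exists f : 'I_(nb_vertices G) -> 'I_N,
    (forall i j : 'I_(nb_vertices G), (i < j)%N -> (f i < f j)%N) /\
    (forall e : {set 'I_(nb_vertices G)}, e \in edges G -> chi (f @: e) = color).

(* The color true is red and false is blue. *)
Definition ordered_arrow (k : nat) (G H : ordered_hypergraph k) (N : nat)
    : Prop :=
  forall chi : {set 'I_N} -> bool, mono_copy G chi true \/ mono_copy H chi false.

Definition is_ordered_ramsey (k : nat) (G H : ordered_hypergraph k) (N : nat)
    : Prop :=
  ordered_arrow G H N /\ (forall M, ordered_arrow G H M -> (N <= M)%N).

Definition complete_edges (k s : nat) : {set {set 'I_s}} :=
  [set e : {set 'I_s} | #|e| == k].

Lemma complete_edges_uniform (k s : nat) (e : {set 'I_s}) :
  e \in complete_edges k s -> #|e| = k.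
Proof. by rewrite inE => /eqP. Qed.

Definition complete_hypergraph (k s : nat) : ordered_hypergraph k :=
  OrderedHypergraph (@complete_edges_uniform k s).

Definition path_edge (k n i : nat) : {set 'I_n} :=
  [set j : 'I_n | (i <= j < i + k)%N].

Definition path_edges (k n : nat) : {set {set 'I_n}} :=
  [set path_edge k n i | i : 'I_n.+1 & (i + k <= n)%N].

Lemma path_edges_uniform (k n : nat) (e : {set 'I_n}) :
  e \in path_edges k n -> #|e| = k.
Proof.
case/imsetP => i; rewrite inE => le_ikn ->.
have lt_n (j : 'I_k) : (i + j < n)%N.
  by apply: leq_trans le_ikn; rewrite ltn_add2l.
pose f (j : 'I_k) := Ordinal (lt_n j).
have f_inj : injective f by move=> a b [] /addnI /val_inj.
suff -> : path_edge k n i = f @: [set: 'I_k].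
  by rewrite card_imset // cardsT card_ord.
apply/setP => j; rewrite !inE; apply/idP/imsetP => [/andP[le_ij lt_j]|[a _ ->]].
  have lt_jk : (j - i < k)%N by rewrite ltn_subLR.
  by exists (Ordinal lt_jk) => //; apply: val_inj; rewrite /= subnKC.
by rewrite /= leq_addr ltn_add2l ltn_ord.
Qed.

Definition monotone_path (k n : nat) : ordered_hypergraph k :=
  OrderedHypergraph (@path_edges_uniform k n).

(* twr 1 x = x and twr i.+1 x = 2 ^ twr i x for i >= 1; twr 0 is meaningless. *)
Definition twr (R : realType) (i : nat) (x : R) : R :=
  iter i.-1 (fun y : R => 2 `^ y) x.

Definition log2 (R : realType) (x : R) : R := ln x / ln 2.

(* Main.v *)
Require Import Defs.
From Stdlib Require Import Classical.
From mathcomp Require Import all_boot all_order all_algebra.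
From mathcomp Require Import zify.

(** For k = 3, give a pair x < y the label l(x, y), the length of a longest blue
    tight path ending in (x, y).  With no blue P_n there are fewer than n labels,
    and x < y < z is red as soon as l(y, z) <= l(x, y); so it suffices to find a
    clique that is descending in this sense.  Suppose S has no descending
    s-clique with labels in an interval I, and let c be the midpoint of I.  If v
    sends labels of I that are >= c to all of S', then S' has no descending
    (s-1)-clique with labels of I that are <= c; dually, if S' sends labels of I
    that are < c to some w, then S' has none with labels of I that are >= c.
    One of the two happens for a large part S' of S, and I is replaced by its two
    halves, for one of which s has dropped by one.  Starting from the interval of
    all labels there are only O((log n)^(s-2)) such replacements before no pair
    is left.

    The Erdos-Rado argument passes from k to k + 1 at the cost of one
    exponential.  If k > s, then K_s has no edge, so only finitely many k matter
    for the constant. *)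

Set Implicit Arguments.
Unset Strict Implicit.
Unset Printing Implicit Defensive.

(** * Descending cliques *)

Definition descending (N : nat) (l : 'I_N -> 'I_N -> nat) (a b : nat)
    (X : {set 'I_N}) : Prop :=
  {in X &, forall x y : 'I_N, x < y -> a <= l x y < b} /\
  {in X & &, forall x y z : 'I_N, x < y -> y < z -> l y z <= l x y}.

Definition clique_free (N : nat) (l : 'I_N -> 'I_N -> nat) (S : {set 'I_N})
    (a b t : nat) : Prop :=
  forall X : {set 'I_N}, X \subset S -> #|X| = t -> ~ descending l a b X.

Lemma clique_freeW N (l : 'I_N -> 'I_N -> nat) (S S' : {set 'I_N}) a b a' b' t :
  S' \subset S -> a <= a' -> b' <= b ->
  clique_free l S a b t -> clique_free l S' a' b' t.
Proof.
move=> sS aa bb free X sX cX [lX dX]; apply: (free X (subset_trans sX sS) cX).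
split=> // x y xX yX xy; have /andP[h1 h2] := lX x y xX yX xy.
by rewrite (leq_trans aa h1) (leq_trans h2 bb).
Qed.

(** Putting [v] in front of a descending clique [X] keeps it descending, since the labels from [v]
    are at least [c] and those inside [X] at most [c]. The end [c.+1] admits the label [c]
    itself. *)
Lemma clique_free_out N (l : 'I_N -> 'I_N -> nat) (S : {set 'I_N}) a b c t
    (v : 'I_N) : a <= c -> c < b -> v \in S -> clique_free l S a b t.+1 ->
  clique_free l [set y in S | (v < y) && (c <= l v y < b)] a c.+1 t.
Proof.
move=> ac cb vS free X sX cX [lX dX].
have XP y : y \in X -> [/\ y \in S, v < y, c <= l v y & l v y < b].
  by move/(subsetP sX); rewrite inE => /and4P[].
have vX : v \notin X by apply/negP => /XP[_]; rewrite ltnn.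
apply: (free (v |: X)).
- by apply/subsetP=> y /setU1P[->//|/XP[]].
- by rewrite cardsU1 vX cX.
split=> [x y /setU1P[->|xX] /setU1P[->|yX]|x y z /setU1P[->|xX] /setU1P[->|yX] /setU1P[->|zX]];
  rewrite ?ltnn //.
- by have [_ _ h1 h2] := XP _ yX => _; rewrite h2 (leq_trans ac h1).
- by have [_ h _ _] := XP _ xX; rewrite ltnNge ltnW.
- by move=> /(lX x y xX yX) /andP[-> /leq_trans ->].
- by have [_ h _ _] := XP _ yX => _; rewrite ltnNge ltnW.
- have [_ _ h _] := XP _ yX => _ /(lX y z yX zX) /andP[_ h2].
  by apply: leq_trans h; rewrite -ltnS.
- by have [_ h _ _] := XP _ xX; rewrite ltnNge ltnW.
- by have [_ h _ _] := XP _ yX => _; rewrite ltnNge ltnW.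
- exact: dX.
Qed.

(** Dually, [w] is appended after [X]: the labels into [w] are at most [c] and those inside [X] at
    least [c]. *)
Lemma clique_free_in N (l : 'I_N -> 'I_N -> nat) (S : {set 'I_N}) a b c t
    (w : 'I_N) : a <= c -> c < b -> w \in S -> clique_free l S a b t.+1 ->
  clique_free l [set x in S | (x < w) && (a <= l x w <= c)] c b t.
Proof.
move=> ac cb wS free X sX cX [lX dX].
have XP y : y \in X -> [/\ y \in S, y < w, a <= l y w & l y w <= c].
  by move/(subsetP sX); rewrite inE => /and4P[].
have wX : w \notin X by apply/negP => /XP[_]; rewrite ltnn.
apply: (free (w |: X)).
- by apply/subsetP=> y /setU1P[->//|/XP[]].
- by rewrite cardsU1 wX cX.
split=> [x y /setU1P[->|xX] /setU1P[->|yX]|x y z /setU1P[->|xX] /setU1P[->|yX] /setU1P[->|zX]];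
  rewrite ?ltnn //.
- by have [_ h _ _] := XP _ yX; rewrite ltnNge ltnW.
- by have [_ _ h1 h2] := XP _ xX => _; rewrite h1 (leq_ltn_trans h2 cb).
- by move=> /(lX x y xX yX) /andP[/(leq_trans ac) -> ->].
- by have [_ h _ _] := XP _ yX; rewrite ltnNge ltnW.
- by have [_ h _ _] := XP _ yX; rewrite ltnNge ltnW.
- by have [_ h _ _] := XP _ zX => _; rewrite ltnNge ltnW.
- by have [_ _ _ h] := XP _ yX => /(lX x y xX yX) /andP[h2 _] _; apply: leq_trans h h2.
- exact: dX.
Qed.

(* An upper bound for the number of replacements caused by an interval of [2 ^ e]
   labels without descending cliques on [t.+2] vertices. *)
Fixpoint splits (e t : nat) {struct e} : nat :=
  match e, t with
  | 0, _ => t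
  | e'.+1, t'.+1 => (splits e' t'.+1 + splits e' t').+1
  | _.+1, 0 => 0
  end.

Lemma splits0 e : splits e 0 = 0. Proof. by case: e. Qed.

(** In the recursion the successors add up, and [(e+2)^(t+1) + (e+2)^t = (e+3) (e+2)^t <=
    (e+3)^(t+1)]. *)
Lemma splits_bound e t : (splits e t).+1 <= e.+2 ^ t.
Proof.
elim: e t => [|e IH] [|t] //=; first exact: ltn_expl.
have := IH t.+1; have := IH t; rewrite !expnS.
have : e.+2 ^ t <= e.+3 ^ t by case: t => // t; rewrite leq_exp2r.
move: (splits e t) (splits e t.+1) (e.+2 ^ t) (e.+3 ^ t) => u u' A B; nia.
Qed.

(* The item [(a, e, t)] records that there is no descending clique on [t.+2]
   vertices with all labels in [a, a + 2 ^ e). *)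
Notation item := (nat * nat * nat)%type.
Definition item_lo (i : item) := i.1.1.
Definition item_hi (i : item) := i.1.1 + 2 ^ i.1.2.
Definition item_mid (i : item) := i.1.1 + (2 ^ i.1.2)./2.
Definition item_splits (i : item) := splits i.1.2 i.2.
Definition in_item (i : item) (m : nat) := item_lo i <= m < item_hi i.

Definition covered N (l : 'I_N -> 'I_N -> nat) (S : {set 'I_N}) (s : seq item) :=
  {in S &, forall x y : 'I_N, x < y -> has (in_item^~ (l x y)) s}.
Definition all_free N (l : 'I_N -> 'I_N -> nat) (S : {set 'I_N}) (s : seq item) :=
  {in s, forall i, clique_free l S (item_lo i) (item_hi i) i.2.+2}.

(** A pair meets the condition on triples vacuously. Hence an item with [t = 0] contains no label of
    a pair in [S]. *)
Lemma clique_free2 N (l : 'I_N -> 'I_N -> nat) (S : {set 'I_N}) a b (x y : 'I_N) :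
  clique_free l S a b 2 -> x \in S -> y \in S -> x < y -> a <= l x y < b -> False.
Proof.
move=> free xS yS xy lxy; apply: (free [set x; y]).
- by apply/subsetP=> z /set2P[] ->.
- by rewrite cards2; move: xy; rewrite ltn_neqAle => /andP[-> _].
have yx : (y < x) = false by apply/negbTE; rewrite -leqNgt ltnW.
split=> [u v /set2P[]-> /set2P[]->|u v w /set2P[]-> /set2P[]-> /set2P[]->];
  rewrite ?ltnn ?yx //.
Qed.

(** Over all ordered pairs, [g x y + g y x] sums to at least [#|S| * #|S|.-1] and to at most
    [2 * #|S| * B]. *)
Lemma leq_double_count (T : finType) (S : {set T}) (g : T -> T -> nat) (B : nat) :
  {in S &, forall x y, x != y -> 0 < g x y + g y x} ->
  {in S, forall x, \sum_(y in S) g x y <= B} -> #|S|.-1 <= 2 * B.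
Proof.
move=> gpos gB; case: (posnP #|S|) => [->//|S0].
have h : \sum_(x in S) \sum_(y in S) (g x y + g y x) <= #|S| * (2 * B).
  have -> : \sum_(x in S) \sum_(y in S) (g x y + g y x)
    = 2 * \sum_(x in S) \sum_(y in S) g x y.
    under eq_bigr do rewrite big_split.
    by rewrite big_split /= mul2n -addnn; congr (_ + _); rewrite exchange_big.
  rewrite mulnCA leq_mul2l /= -sum_nat_const; exact: leq_sum.
rewrite -(leq_pmul2l S0) -sum_nat_const; apply: leq_trans h; apply: leq_sum => x xS.
have -> : #|S|.-1 = \sum_(y in S | y != x) 1.
  rewrite sum1_card (cardD1 x S) xS /=; apply: eq_card => y.
  by rewrite !inE andbC.
rewrite big_mkcondr; apply: leq_sum => y yS; case: eqP => //= /eqP yx.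
by apply: gpos => //; rewrite eq_sym.
Qed.

Lemma all_freeW N (l : 'I_N -> 'I_N -> nat) (S S' : {set 'I_N}) s :
  S' \subset S -> all_free l S s -> all_free l S' s.
Proof. by move=> sS free i /free; apply: clique_freeW. Qed.

Lemma covered_refine N (l : 'I_N -> 'I_N -> nat) (S S' : {set 'I_N}) s r i :
  i \in s -> S' \subset S -> (forall m, in_item i m -> has (in_item^~ m) r) ->
  covered l S s -> covered l S' (r ++ rem i s).
Proof.
move=> is_ sS ri cov x y xS yS xy; rewrite has_cat.
have := cov x y (subsetP sS _ xS) (subsetP sS _ yS) xy.
by rewrite (perm_has _ (perm_to_rem is_)) /= => /orP[/ri ->|->]; rewrite ?orbT.
Qed.

(** On the first set [clique_free_out] lowers [t] for the lower half of the interval; on the second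
    [clique_free_in] lowers it for the upper half. The other half keeps its [t], so by the recursion
    of [splits] the total drops by exactly one. *)
Lemma split_item N (l : 'I_N -> 'I_N -> nat) (S : {set 'I_N}) (i : item) (v : 'I_N) :
  v \in S -> 0 < item_splits i ->
  clique_free l S (item_lo i) (item_hi i) i.2.+2 ->
  forall T : {set 'I_N},
  T = [set y in S | (v < y) && (item_mid i <= l v y < item_hi i)] \/
  T = [set x in S | (x < v) && (item_lo i <= l x v < item_mid i)] ->
  T = set0 \/ exists r : seq item,
   [/\ size r <= 2, (\sum_(j <- r) item_splits j).+1 = item_splits i,
       forall m, in_item i m -> has (in_item^~ m) r & all_free l T r].
Proof.
case: i => [[a e] t]; rewrite /item_splits /item_lo /item_hi /item_mid /in_item /=.
move=> vS; case: t => [|t]; first by rewrite splits0.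
move=> _ free T; case: e free => [|e] /= free.
  (* A single label is its own midpoint: the second set is empty, and on the first one [t] drops by
     one without any halving. *)
  rewrite addn0 addn1 in free *.
  case=> ->; [right|left].
    exists [:: (a, 0, t)]; split=> //=.
    - by rewrite big_seq1.
    - by move=> m; rewrite orbF.
    move=> j /[1!inE] /eqP-> /=; rewrite /item_lo /item_hi /= addn1.
    exact: (clique_free_out _ _ vS free).
  apply/setP=> x; rewrite !inE; apply/negbTE; rewrite !negb_and -!leqNgt.
  by case: (leqP a (l x v)); rewrite ?orbT // -?ltnNge => _; rewrite !orbT.
have half2 : (2 ^ e.+1)./2 = 2 ^ e by rewrite expnS mul2n doubleK.
have e0 : 0 < 2 ^ e by rewrite expn_gt0.
have e2 : 2 ^ e.+1 = 2 ^ e + 2 ^ e by rewrite expnS mul2n addnn.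
rewrite half2 e2 in free *.
have lo : a <= a + 2 ^ e by lia.
have hi : a + 2 ^ e < a + (2 ^ e + 2 ^ e) by lia.
have cov t1 t2 m : a <= m < a + (2 ^ e + 2 ^ e) ->
    has (in_item^~ m) [:: (a, e, t1); (a + 2 ^ e, e, t2)].
  by rewrite /= orbF /in_item /item_lo /item_hi /=; lia.
case=> ->; right.
  exists [:: (a, e, t); (a + 2 ^ e, e, t.+1)]; split=> //=.
  - by rewrite !big_cons big_nil /item_splits /= addn0 addnC.
  - by move=> m; rewrite /item_lo /item_hi /= e2; apply: cov.
  - move=> j; rewrite !inE => /orP[]/eqP->; rewrite /item_lo /item_hi /=.
      by apply: clique_freeW (clique_free_out lo hi vS free) => //.
    apply: clique_freeW free => //; last by rewrite addnA.
    by apply/subsetP=> y /[1!inE] /andP[].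
exists [:: (a, e, t.+1); (a + 2 ^ e, e, t)]; split=> //=.
- by rewrite !big_cons big_nil /item_splits /= addn0.
- by move=> m; rewrite /item_lo /item_hi /= e2; apply: cov.
- move=> j; rewrite !inE => /orP[]/eqP->; rewrite /item_lo /item_hi /=.
    apply: clique_freeW free => //; last by lia.
    by apply/subsetP=> y /[1!inE] /andP[].
  apply: clique_freeW (clique_free_in lo hi vS free) => //; last by rewrite addnA.
  apply/subsetP=> x; rewrite !inE => /and4P[-> -> -> /ltnW ->] //.
Qed.

(* A replacement adds at most one item and uses up one split, so [p] bounds the
   number of items throughout. *)
Lemma card_free_bound N (l : 'I_N -> 'I_N -> nat) p k (s : seq item)
    (S : {set 'I_N}) :
  \sum_(i <- s) item_splits i = k -> size s + k <= p ->
  covered l S s -> all_free l S s -> #|S| <= (8 * p) ^ k.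
Proof.
elim: k s S => [|k IH] s S sum_s size_s cov free.
  (* With no splits left every item has [t = 0] and contains no label, so [S] has no pair. *)
  rewrite expn0; apply/card_le1_eqP.
  have none (x y : 'I_N) : x \in S -> y \in S -> x < y -> False.
    move=> xS yS xy; have /hasP[[[a e] t] is_ lxy] := cov x y xS yS xy.
    have : item_splits (a, e, t) = 0.
      apply/eqP; move/eqP: sum_s; rewrite (perm_big _ (perm_to_rem is_)) big_cons.
      by rewrite addn_eq0 => /andP[].
    have := free _ is_; case: t {is_} lxy => [|t] lxy; last by case: e lxy.
    by move=> fr _; apply: clique_free2 fr xS yS xy lxy.
  move=> x y xS yS; apply/val_inj => /=.
  by case: (ltngtP x y) => // xy; [case: (none _ _ xS yS xy)|case: (none _ _ yS xS xy)].
pose D := (8 * p) ^ k.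
pose out i (v : 'I_N) := [set y in S | (v < y) && (item_mid i <= l v y < item_hi i)].
pose inn i (v : 'I_N) := [set x in S | (x < v) && (item_lo i <= l x v < item_mid i)].
(* A neighbourhood through one item is empty or, after [split_item], falls under the induction
   hypothesis. *)
have small (i : item) (v : 'I_N) (T : {set 'I_N}) : i \in s -> v \in S -> T = out i v \/ T = inn i v -> #|T| <= D.
  move=> is_ vS TE.
  have TS : T \subset S by case: TE => ->; apply/subsetP=> y /[1!inE] /andP[].
  have [i0|ipos] := posnP (item_splits i).
    suff -> : T = set0 by rewrite cards0.
    have none (x y : 'I_N) : x \in S -> y \in S -> x < y -> in_item i (l x y) -> False.
      move: (free _ is_) i0; case: i {is_ TE} => [[a e] [|t]] /=; last by case: e.
      by move=> fr _ xS yS xy; apply: clique_free2 fr xS yS xy.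
    have [lm mh] : item_lo i <= item_mid i /\ item_mid i <= item_hi i.
      by rewrite /item_lo /item_hi /item_mid; split; rewrite ?leq_addr // leq_add2l; lia.
    apply/setP=> y; rewrite [y \in set0]inE; apply/negbTE/negP.
    case: TE => ->; rewrite inE => /and4P[yS h1 h2 h3].
      by apply: (none v y) => //; rewrite /in_item h3 (leq_trans lm h2).
    by apply: (none y v) => //; rewrite /in_item h2 (leq_trans h3 mh).
  have [->|[r [size_r sum_r cov_r free_r]]] := split_item vS ipos (free _ is_) TE.
    by rewrite cards0.
  have pm := perm_to_rem is_.
  apply: (IH (r ++ rem i s)).
  - by rewrite big_cat /=; move: sum_s; rewrite (perm_big _ pm) big_cons /= -sum_r => -[].
  - move: size_s; rewrite size_cat (perm_size pm) /=; lia.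
  - exact: covered_refine cov.
  - move=> j; rewrite mem_cat => /orP[/free_r//|/mem_rem]; exact: (all_freeW TS free).
(* [g x y] counts the neighbourhoods of [x] that contain [y]. A pair [x < y] is counted at [x] if
   its label is in the upper half of a covering item, and at [y] otherwise. Each vertex has at most
   [2 * p] neighbourhoods, of size at most [D]. *)
pose g x y := \sum_(i <- s) ((y \in out i x) + (y \in inn i x)).
have gpos : {in S &, forall x y, x != y -> 0 < g x y + g y x}.
  have half (x y : 'I_N) : x \in S -> y \in S -> x < y -> 0 < g x y + g y x.
    move=> xS yS xy; have /hasP[i is_ /andP[h1 h2]] := cov x y xS yS xy.
    rewrite /g !(perm_big _ (perm_to_rem is_)) !big_cons /=.
    have : (y \in out i x) || (x \in inn i y).
      by rewrite !inE xS yS xy h1 h2 /=; case: leqP.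
    by case/orP=> ->; rewrite ?addnS ?addSn.
  move=> x y xS yS; rewrite -val_eqE /= neq_ltn => /orP[/half->//|/half].
  by rewrite addnC => ->.
have gB : {in S, forall x, \sum_(y in S) g x y <= p * (2 * D)}.
  move=> x xS; rewrite /g exchange_big /=.
  apply: (@leq_trans (\sum_(i <- s) 2 * D)); last first.
    rewrite big_const_seq count_predT iter_addn_0 mulnC leq_mul2r.
    by apply/orP; right; lia.
  rewrite !big_seq; apply: leq_sum => i is_; rewrite big_split /= mul2n -addnn.
  have cnt (T : {set 'I_N}) : \sum_(y in S) (y \in T) <= #|T|.
    rewrite -sum1_card big_mkcond [leqRHS]big_mkcond; apply: leq_sum => y _.
    by case: (y \in S); case: (y \in T).
  by apply: leq_add; apply: leq_trans (cnt _) _; apply: small is_ xS _; [left|right].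
(* This gives [#|S| <= 4 * p * D + 1], which is at most [8 * p * D]. *)
have := leq_double_count gpos gB.
have : 0 < D by rewrite expn_gt0 muln_gt0; lia.
have : 0 < p by lia.
rewrite expnS -/D; move: (#|S|) => c; nia.
Qed.

(** A single item with all labels starts the process, so [p = (splits e t).+1] suffices. *)
Lemma clique_free_bound N (l : 'I_N -> 'I_N -> nat) e t :
  (forall x y : 'I_N, x < y -> l x y < 2 ^ e) ->
  clique_free l [set: 'I_N] 0 (2 ^ e) t.+2 ->
  N <= (8 * e.+2 ^ t) ^ (e.+2 ^ t).
Proof.
move=> lb free; have sb := splits_bound e t.
have : N <= (8 * (splits e t).+1) ^ splits e t.
  rewrite -[X in X <= _]card_ord -cardsT.
  apply: (@card_free_bound _ l _ _ [:: (0, e, t)]).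
  - by rewrite big_seq1.
  - by [].
  - by move=> x y _ _ xy; rewrite /= orbF; apply: lb.
  - by move=> j /[1!inE] /eqP ->.
move/leq_trans; apply.
apply: (@leq_trans ((8 * e.+2 ^ t) ^ splits e t)).
  by case: (splits e t) sb => // k sb; rewrite leq_exp2r // leq_mul2l.
by rewrite leq_pexp2l ?(ltnW sb) // muln_gt0 expn_gt0.
Qed.

(** * Triple systems *)

Lemma enum_val_ord_mono N (X : {set 'I_N}) (i j : 'I_#|X|) :
  i < j -> enum_val i < enum_val j.
Proof.
move=> ij; have x0 := enum_val i; rewrite !(enum_val_nth x0).
have st : sorted (relpre val ltn) (enum X).
  rewrite /enum_mem -enumT; apply: sorted_filter => [a b c|]; first exact: ltn_trans.
  by rewrite -sorted_map val_enum_ord iota_ltn_sorted.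
have tr : transitive (relpre (val : 'I_N -> nat) ltn) by move=> a b c; exact: ltn_trans.
by apply: (sorted_ltn_nth tr x0 st); rewrite ?inE -?cardE.
Qed.

Lemma ord_mono_inj m N (f : 'I_m -> 'I_N) :
  (forall i j : 'I_m, i < j -> f i < f j) -> injective f.
Proof.
move=> fm i j fij; apply/val_inj => /=.
by case: (ltngtP i j) => // /fm; rewrite fij ltnn.
Qed.

Lemma complete_copyP k s N (chi : {set 'I_N} -> bool) color :
  mono_copy (complete_hypergraph k s) chi color <->
  exists2 X : {set 'I_N}, #|X| = s &
    forall e : {set 'I_N}, e \subset X -> #|e| = k -> chi e = color.
Proof.
split=> [[/= f [fm fc]]|[X cX Xc]].
  have finj := ord_mono_inj fm.
  exists (f @: [set: 'I_s]); first by rewrite card_imset // cardsT card_ord.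
  move=> e eX ce; have ee : f @: (f @^-1: e) = e.
    apply/setP=> y; apply/imsetP/idP => [[x]|ye]; first by rewrite inE => ? ->.
    by have /imsetP[x _ yx] := subsetP eX y ye; exists x; rewrite // inE -yx.
  by rewrite -ee; apply: fc; rewrite inE -(card_imset _ finj) ee ce.
move: s cX => _ <-; exists (fun i => enum_val i); split=> /=; first exact: enum_val_ord_mono.
move=> e; rewrite inE => /eqP ce; apply: Xc.
  by apply/subsetP=> y /imsetP[x _ ->]; apply: enum_valP.
by rewrite card_imset //; apply: enum_val_inj.
Qed.

Lemma path_copy k n N (chi : {set 'I_N} -> bool) color (f : 'I_n -> 'I_N) :
  (forall i j : 'I_n, i < j -> f i < f j) ->
  (forall i, i + k <= n -> chi (f @: path_edge k n i) = color) ->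
  mono_copy (monotone_path k n) chi color.
Proof.
by move=> fm fc; exists f; split=> //= e /imsetP[i]; rewrite inE => ik ->; apply: fc.
Qed.

Lemma ordered_arrowW k (G H : ordered_hypergraph k) M N :
  M <= N -> ordered_arrow G H M -> ordered_arrow G H N.
Proof.
move=> MN arr chi; pose w := widen_ord MN.
have lift (F : ordered_hypergraph k) color :
    mono_copy F (fun A => chi (w @: A)) color -> mono_copy F chi color.
  move=> [f [fm fc]]; exists (w \o f); split=> [i j /fm//|e eF].
  by rewrite imset_comp; apply: fc.
by case: (arr (fun A => chi (w @: A))) => /lift; [left|right].
Qed.

Lemma exists_set_max N (e : {set 'I_N}) : 0 < #|e| ->
  exists2 z, z \in e & {in e :\ z, forall x : 'I_N, x < z}.
Proof.
case/card_gt0P=> x0 x0e; case: (@arg_maxnP _ x0 (mem e) val x0e) => z ze zmax.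
exists z => // x; rewrite !inE => /andP[xz xe].
by rewrite ltn_neqAle xz; apply: zmax.
Qed.

Lemma set3_sorted N (e : {set 'I_N}) : #|e| = 3 ->
  exists x y z : 'I_N, [/\ x < y, y < z & e = [set x; y; z]].
Proof.
move=> ce; have [|z ze zm] := @exists_set_max _ e; first by rewrite ce.
have ce2 : #|e :\ z| = 2 by have := cardsD1 z e; rewrite ze ce add1n => -[].
have [|y ye ym] := @exists_set_max _ (e :\ z); first by rewrite ce2.
have /eqP/cards1P[x xE] : #|(e :\ z) :\ y| = 1.
  by have := cardsD1 y (e :\ z); rewrite ye ce2 add1n => -[].
exists x, y, z; split; [by apply: ym; rewrite xE set11|exact: zm|].
by rewrite -(setD1K ze) -(setD1K ye) xE setUC (setUC [set y]).
Qed.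

(* There is a blue tight path on [j.+2] vertices ending in [x], [y]. *)
Fixpoint blue_tail N (chi : {set 'I_N} -> bool) (j : nat) (x y : 'I_N) : bool :=
  (x < y) &&
  match j with
  | 0 => true
  | j'.+1 => [exists w, ~~ chi [set w; x; y] && blue_tail chi j' w x]
  end.

Lemma blue_tail_path N (chi : {set 'I_N} -> bool) j (x y : 'I_N) :
  blue_tail chi j x y -> exists g : nat -> 'I_N,
  [/\ g j = x, g j.+1 = y, forall i, i <= j -> g i < g i.+1 &
      forall i, i < j -> chi [set g i; g i.+1; g i.+2] = false].
Proof.
elim: j x y => [|j IH] x y /= /andP[xy].
  move=> _; exists (fun i => if i is 0 then x else y); split=> // i.
  by rewrite leqn0 => /eqP ->.
case/existsP=> w /andP[/negbTE c /IH [g [gx gy gm gc]]].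
exists (fun i => if i <= j.+1 then g i else y).
split=> [||i|i]; rewrite ?leqnn ?ltnn //.
- case: (ltngtP i j.+1) => // [ij|->] _; first by rewrite gm // -ltnS.
  by rewrite gy.
- rewrite ltnS => ij; rewrite (leqW ij) ij [_ < j.+1]ltnS.
  case: (ltngtP i j) ij => // [ij|->] _; first exact: gc.
  by rewrite gx gy.
Qed.

Lemma blue_tail_copy N (chi : {set 'I_N} -> bool) m (x y : 'I_N) :
  blue_tail chi m x y -> mono_copy (monotone_path 3 m.+2) chi false.
Proof.
case/blue_tail_path=> g [_ _ gm gc].
have gm' i j : i < j -> j <= m.+1 -> g i < g j.
  elim: j => // j IH; rewrite ltnS leq_eqVlt => /orP[/eqP->|ij] jm; first exact: gm.
  by apply: ltn_trans (IH ij (ltnW jm)) (gm _ _).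
apply: (@path_copy _ _ _ _ _ (fun i => g i)) => [i j ij|i im].
  by apply: gm' => //; rewrite -ltnS.
rewrite -(gc i); last by lia.
have lt u : u < 3 -> i + u < m.+2 by lia.
congr (chi _); apply/setP=> z; rewrite !inE; apply/imsetP/idP.
  move=> [u]; rewrite inE => /andP[iu ui] ->.
  have : (u == i :> nat) || (u == i.+1 :> nat) || (u == i.+2 :> nat) by lia.
  by case/orP=> [/orP[]|] /eqP->; rewrite eqxx ?orbT.
case/orP=> [/orP[]|] /eqP->.
- by exists (Ordinal (lt 0 isT)); rewrite ?inE /= ?addn0 //; lia.
- by exists (Ordinal (lt 1 isT)); rewrite ?inE /= ?addn1 //; lia.
- by exists (Ordinal (lt 2 isT)); rewrite ?inE /= ?addn2 //; lia.
Qed.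

Lemma ordered_arrow3 e t m N : m.+1 < 2 ^ e ->
  (8 * e.+2 ^ t) ^ (e.+2 ^ t) < N ->
  ordered_arrow (complete_hypergraph 3 t.+2) (monotone_path 3 m.+2) N.
Proof.
move=> me big chi; apply: NNPP => /not_or_and[nred nblue].
have nb x y : blue_tail chi m x y = false.
  by apply/negbTE/negP => /blue_tail_copy.
(* Tails can be shortened at their start, so counting the possible [j] measures the longest tail. *)
pose l x y := \sum_(j < m.+1) blue_tail chi j x y.
have lblue (w x y : 'I_N) : w < x -> x < y -> chi [set w; x; y] = false -> l w x < l x y.
  (* The term [j = m] of [l w x] vanishes for lack of a blue path, and the term [j = 0] of [l x y]
     is 1. The others compare after a shift, by prolonging a tail through [y]. *)
  move=> wx xy c; rewrite /l big_ord_recr /= nb addn0 big_ord_recl /= xy add1n ltnS.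
  apply: leq_sum => j _; case E: (blue_tail chi j w x) => //=; rewrite lt0b.
  by apply/existsP; exists w; rewrite c E.
have free : clique_free l [set: 'I_N] 0 (2 ^ e) t.+2.
  move=> X _ cX [_ dX]; apply: nred; apply/complete_copyP; exists X => // f fX cf.
  have [x [y [z [xy yz fE]]]] := set3_sorted cf.
  have [xX yX zX] : [/\ x \in X, y \in X & z \in X].
    by split; apply: (subsetP fX); rewrite fE !inE eqxx ?orbT.
  rewrite fE; apply: contraTT (dX _ _ _ xX yX zX xy yz); rewrite -ltnNge.
  by move=> /negbTE; apply: lblue.
move: big; rewrite ltnNge => /negP; apply; apply: clique_free_bound free => x y _.
apply: leq_ltn_trans me; rewrite /l -[leqRHS]card_ord -sum1_card.
by apply: leq_sum => j _; apply: leq_b1.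
Qed.

(** * The Erdos-Rado step *)

Lemma bin_leq_exp n k : 'C(n, k) <= n ^ k.
Proof.
elim: k n => [|k IH] n; first by rewrite bin0.
apply: (@leq_trans (k.+1 * 'C(n, k.+1))); first exact: leq_pmull.
rewrite -mul_bin_diag expnS leq_mul2l; apply/orP; right.
apply: leq_trans (IH _) _; case: k {IH} => // k; rewrite leq_exp2r //; exact: leq_pred.
Qed.

Lemma pigeonhole_set (T F : finType) (S : {set T}) (f : T -> F) (P : {set F}) :
  {in S, forall x, f x \in P} ->
  exists S' : {set T}, [/\ S' \subset S, {in S' &, forall x y, f x = f y} &
    #|S| <= #|P| * #|S'|].
Proof.
move=> fP; have [->|[x0 x0S]] := set_0Vmem S.
  by exists set0; split; rewrite ?cards0 // => x; rewrite inE.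
pose fib c := [set x in S | f x == c].
case: (@arg_maxnP _ (f x0) (mem P) (fun c => #|fib c|) (fP _ x0S)) => c cP cmax.
exists (fib c); split.
- by apply/subsetP=> x /[1!inE] /andP[].
- by move=> x y /[!inE] /andP[_ /eqP->] /andP[_ /eqP->].
rewrite -sum1_card (partition_big f (mem P)) //= -sum_nat_const; apply: leq_sum => d dP.
apply: leq_trans (cmax d dP); rewrite sum1_card.
by apply: subset_leq_card; apply/subsetP=> x; rewrite !inE.
Qed.

(** [V] holds the vertices chosen so far, [S] the reservoir from which later ones are taken. *)
Definition end_homogeneous N (k : nat) (chi : {set 'I_N} -> bool)
    (V S : {set 'I_N}) : Prop :=
  forall A : {set 'I_N}, A \subset V -> #|A| = k ->
  {in V :|: S &, forall x y : 'I_N, {in A, forall a : 'I_N, a < x} ->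
     {in A, forall a : 'I_N, a < y} -> chi (x |: A) = chi (y |: A)}.

Lemma exists_set_min N (e : {set 'I_N}) : 0 < #|e| ->
  exists2 z, z \in e & {in e :\ z, forall x : 'I_N, z < x}.
Proof.
case/card_gt0P=> x0 x0e; case: (@arg_minnP _ x0 (mem e) val x0e) => z ze zmin.
exists z => // x; rewrite !inE => /andP[xz xe].
by rewrite ltn_neqAle eq_sym xz; apply: zmin.
Qed.

(** Move the least vertex [v] of [S] to [V], and keep the largest class of the remaining vertices
    that extend every [k]-subset of the new [V] in the same colour. There are at most [2 ^ (M ^ k)]
    classes; the extra factor 2 pays for the loss of [v]. *)
Lemma end_homogeneous_extend N k M (chi : {set 'I_N} -> bool) j (V S : {set 'I_N}) :
  {in V & S, forall v x : 'I_N, v < x} -> end_homogeneous k chi V S ->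
  #|V| + j <= M -> (2 * 2 ^ (M ^ k)) ^ j <= #|S| ->
  exists2 V' : {set 'I_N}, #|V'| = #|V| + j & end_homogeneous k chi V' set0.
Proof.
elim: j V S => [|j IH] V S VS hom VM Sbig.
  exists V; first by rewrite addn0.
  move=> A AV cA x y; rewrite setU0 => xV yV.
  by apply: (hom A AV cA); rewrite inE ?xV ?yV.
have [|v vS vmin] := @exists_set_min _ S.
  by apply: leq_trans Sbig; rewrite expn_gt0 muln_gt0 expn_gt0.
have vV : v \notin V by apply/negP => /VS /(_ vS); rewrite ltnn.
pose V1 := v |: V; have cV1 : #|V1| = #|V|.+1 by rewrite cardsU1 vV.
pose AA := [set A : {set 'I_N} | A \subset V1 & #|A| == k].
pose f (x : 'I_N) := [set A in AA | chi (x |: A)].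
have [|S' [sS' fS' cS']] := @pigeonhole_set _ _ (S :\ v) f (powerset AA).
  by move=> x _; rewrite inE; apply/subsetP=> A /[1!inE] /andP[].
have Wb : #|powerset AA| <= 2 ^ (M ^ k).
  rewrite card_powerset leq_exp2l // cards_draws cV1.
  apply: leq_trans (bin_leq_exp _ _) _; case: (k) => // k'; rewrite leq_exp2r //.
  by apply: leq_trans VM; rewrite addnS ltnS leq_addr.
have S'S x : x \in S' -> v < x /\ x \in S.
  by move=> /(subsetP sS') xS; split; [exact: vmin|move: xS; rewrite !inE => /andP[]].
have [| | | |V' cV' homV'] := IH V1 S'.
- move=> u x /setU1P[->|uV] /S'S[vx xS] //; exact: VS.
(* If [v] is in [A], vertices above [A] lie in [S'] and belong to one class; otherwise the old
   homogeneity applies. *)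
- move=> A AV1 cA x y xV yV Ax Ay; case: (boolP (v \in A)) => vA.
    have inS' z : z \in V1 :|: S' -> {in A, forall a : 'I_N, a < z} -> z \in S'.
      move=> + /(_ v vA) vz; rewrite !inE => /orP[/orP[/eqP zv|zV]|//].
        by rewrite zv ltnn in vz.
      by have := VS _ _ zV vS; rewrite ltnNge ltnW.
    have /setP/(_ A) := fS' x y (inS' x xV Ax) (inS' y yV Ay).
    by rewrite !inE AV1 cA eqxx.
  have AV : A \subset V.
    apply/subsetP=> a aA; have := subsetP AV1 a aA; rewrite !inE => /orP[/eqP av|//].
    by rewrite -av aA in vA.
  have sub z : z \in V1 :|: S' -> z \in V :|: S.
    rewrite !inE => /orP[/orP[/eqP->|->//]|/S'S[_ ->]]; rewrite ?vS ?orbT //.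
  by apply: (hom A AV cA) => //; apply: sub.
- by rewrite cV1 addSnnS.
- have := cardsD1 v S; rewrite vS; move: Sbig; rewrite expnS.
  have W0 : 0 < 2 ^ (M ^ k) by rewrite expn_gt0.
  move: cS' Wb W0; move: (#|S :\ v|) (#|S|) (#|S'|) (#|powerset AA|).
  move: (2 ^ (M ^ k)) ((2 * 2 ^ (M ^ k)) ^ j) => W B a b c d h1 h2 h3 h4 h5.
  rewrite leqNgt; apply/negP => h.
  have : d * c <= W * c by rewrite leq_mul2r h2 orbT.
  have : W * c.+1 <= W * B by rewrite leq_mul2l h orbT.
  nia.
by exists V' => //; rewrite cV' cV1 addSnnS.
Qed.

(** On an end-homogeneous set of size [M], colour a [k]-set by the colour of its extensions.
    Removing the last vertex turns edges of a clique or a path into edges of the same kind for [k],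
    so [s] and [n] do not change. *)
Lemma ordered_arrow_step k s n M N : 0 < k -> (2 * 2 ^ (M ^ k)) ^ M <= N ->
  ordered_arrow (complete_hypergraph k s) (monotone_path k n) M ->
  ordered_arrow (complete_hypergraph k.+1 s) (monotone_path k.+1 n) N.
Proof.
move=> k0 Nbig arr chi.
have [| | | |V] := @end_homogeneous_extend N k M chi M set0 [set: 'I_N].
- by move=> v x; rewrite inE.
- by move=> A; rewrite subset0 => /eqP->; rewrite cards0 => k0'; rewrite -k0' in k0.
- by rewrite cards0.
- by rewrite cardsT card_ord.
rewrite cards0 add0n => cV hom; move: M cV arr {Nbig} => _ <- arr.
pose g (i : 'I_#|V|) : 'I_N := enum_val i.
have gm (i j : 'I_#|V|) : i < j -> g i < g j by exact: enum_val_ord_mono.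
have ginj : injective g by exact: ord_mono_inj gm.
(* The value defaults to false when no vertex of [V] lies above [B]; [chi'E] is applied only to
   edges without their last vertex, which then serves as [z]. *)
pose chi' (B : {set 'I_#|V|}) :=
  [exists x, [&& x \in V, [forall a in g @: B, a < x] & chi (x |: g @: B)]].
have chi'E (B : {set 'I_#|V|}) z : #|B| = k -> z \in V ->
    {in g @: B, forall a : 'I_N, a < z} -> chi (z |: g @: B) = chi' B.
  move=> cB zV Bz; apply/idP/existsP => [cz|[x /and3P[xV /forall_inP Bx]]].
    by exists z; rewrite zV cz andbT; apply/forall_inP.
  suff -> : chi (x |: g @: B) = chi (z |: g @: B) by [].
  apply: hom => //; rewrite ?setU0 ?card_imset //.
  by apply/subsetP=> y /imsetP[i _ ->]; apply: enum_valP.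
have [red|[f [fm fc]]] := arr chi'; [left|right].
  have [X cX Xc] := (complete_copyP _ _ _ _).1 red.
  apply/complete_copyP; exists (g @: X); first by rewrite card_imset.
  move=> e eX ce; have [|z ze zmax] := @exists_set_max _ e; first by rewrite ce.
  pose B := g @^-1: (e :\ z).
  have gB : g @: B = e :\ z.
    apply/setP=> y; apply/imsetP/idP => [[i]|ye]; first by rewrite inE => ? ->.
    have /imsetP[i _ yi] := subsetP eX y (subsetP (subD1set e z) y ye).
    by exists i; rewrite // inE -yi.
  have cB : #|B| = k.
    by rewrite -(card_imset _ ginj) gB; have := cardsD1 z e; rewrite ze ce => -[].
  have BX : B \subset X.
    apply/subsetP=> i; rewrite inE => /(subsetP (subD1set e z)) /(subsetP eX).
    by rewrite mem_imset.
  rewrite -(setD1K ze) -gB chi'E ?Xc //; last by rewrite gB.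
  by have /imsetP[i _ ->] := subsetP eX z ze; apply: enum_valP.
apply: (@path_copy _ _ _ _ _ (g \o f)) => [i j /fm/gm//|i ik].
have lt_z : i + k < n by rewrite -addnS.
pose z : 'I_n := Ordinal lt_z.
have -> : path_edge k.+1 n i = z |: path_edge k n i.
  by apply/setP=> j; rewrite !inE -val_eqE /=; lia.
have i_lt : i < n.+1 by lia.
have ed : path_edge k n i \in edges (monotone_path k n).
  by apply/imsetP; exists (Ordinal i_lt); rewrite // inE /=; lia.
rewrite imsetU1 imset_comp chi'E; first exact: fc.
- rewrite card_imset; last exact: ord_mono_inj fm.
  exact: (@path_edges_uniform k n).
- exact: enum_valP.
- move=> a /imsetP[b /imsetP[j]]; rewrite inE => /andP[_ jz] -> ->.
  by apply/gm/fm.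
Qed.

(** * Tower bounds *)

Lemma iter_exp2_gt1 j x : 1 < x -> 1 < iter j (expn 2) x.
Proof. by move=> x1; elim: j => //= j IH; rewrite -{1}(expn0 2) ltn_exp2l // ltnW. Qed.

Lemma leq_iter_exp2 j x y : x <= y -> iter j (expn 2) x <= iter j (expn 2) y.
Proof. by move=> xy; elim: j => //= j IH; rewrite leq_exp2l. Qed.

Lemma iter_exp2_ge j x : x <= iter j (expn 2) x.
Proof. by elim: j => //= j IH; apply: leq_trans IH (ltnW (ltn_expl _ _)). Qed.

(** A power sinks to the bottom of a tower because [(2 ^ y) ^ m = 2 ^ (y * m)] and [y * m <= y ^ m]
    for [y > 1]. *)
Lemma iter_exp2_pow j x m : 1 < x -> 0 < m ->
  iter j (expn 2) x ^ m <= iter j (expn 2) (x ^ m).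
Proof.
move=> x1 m0; elim: j => //= j IH; rewrite -expnM leq_exp2l //.
apply: leq_trans IH; have := iter_exp2_gt1 j x1; move: (iter _ _ _) => y y1.
case: m m0 => // m _; rewrite expnS leq_mul2l; apply/orP; right.
apply: (leq_trans (ltn_expl m (isT : 1 < 2))).
by case: m => // m; rewrite leq_exp2r.
Qed.

(** The factorial collects the factor [j + 5] that each Erdos-Rado step adds to the bottom exponent,
    starting from [4! = 24]. *)
Lemma ordered_arrow_tower e t m j : m.+1 < 2 ^ e ->
  ordered_arrow (complete_hypergraph (j + 3) t.+2) (monotone_path (j + 3) m.+2)
    (iter j (expn 2) (2 ^ ((t + 4) * (j + 4)`! * e.+2 ^ t.+1))).
Proof.
move=> me; elim: j => [|j IH].
  apply: (ordered_arrow3 me) => /=.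
  have rt : e.+2 ^ t <= 2 ^ (e.+2 * t).
    by rewrite expnM; case: (t) => // t'; rewrite leq_exp2r // ltnW // ltn_expl.
  have h : 8 * e.+2 ^ t <= 2 ^ (3 + e.+2 * t) by rewrite expnD leq_mul.
  have r0 : 0 < e.+2 ^ t by rewrite expn_gt0.
  apply: (@leq_ltn_trans ((2 ^ (3 + e.+2 * t)) ^ (e.+2 ^ t))); first by rewrite leq_exp2r.
  rewrite -expnM ltn_exp2l // expnS add0n (_ : 4`! = 24) // mulnA ltn_pmul2r //.
  nia.
set x := 2 ^ _ in IH; have x1 : 1 < x.
  by rewrite -{1}(expn0 2) ltn_exp2l // !muln_gt0 fact_gt0 expn_gt0 addn_gt0 orbT.
set M := iter j _ _ in IH; have M1 : 1 < M by apply: iter_exp2_gt1.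
rewrite addSn; apply: ordered_arrow_step IH; first by lia.
rewrite /= expnMn -expnM -expnD leq_exp2l //.
(* The exponent [M + M ^ (j + 3) * M] is at most [M ^ (j + 5)], as [M >= 2]. *)
apply: (@leq_trans (M ^ (j + 5))).
  have -> : j + 5 = (j + 3).+2 by lia.
  rewrite !expnS; have : 0 < M ^ (j + 3) by rewrite expn_gt0 ltnW.
  by move: (M ^ _) => P; nia.
apply: leq_trans (iter_exp2_pow j x1 (_ : 0 < j + 5)) _; first by lia.
rewrite -expnM; apply: leq_iter_exp2; rewrite leq_exp2l //.
have -> : (j.+1 + 4)`! = (j + 5) * (j + 4)`! by rewrite addSn factS (addnS j 4).
by move: (_ `!) (_ ^ _) => F P; lia.
Qed.

Lemma ordered_arrow_trivial k s n : s < k ->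
  ordered_arrow (complete_hypergraph k s) (monotone_path k n) s.
Proof.
move=> sk chi; left; apply/complete_copyP; exists [set: 'I_s].
  by rewrite cardsT card_ord.
by move=> e _ ce; have := max_card (mem e); rewrite ce card_ord leqNgt sk.
Qed.

(* Real towers and the choice of the constant *)
From mathcomp Require Import all_classical all_reals all_analysis.
Import Order.TTheory GRing.Theory Num.Theory.
Local Open Scope ring_scope.

Lemma natr_iter_exp2 (R : realType) j x :
  (iter j (expn 2) x)%:R = iter j (fun y : R => 2 `^ y) x%:R.
Proof. by elim: j => //= j <-; rewrite powR_mulrn // natrX. Qed.

Lemma ler_iter_powR2 (R : realType) j (x y : R) : x <= y ->
  iter j (fun y : R => 2 `^ y) x <= iter j (fun y : R => 2 `^ y) y.
Proof. by move=> xy; elim: j => //= j IH; rewrite ler_powR // ler1n. Qed.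

Lemma trunc_log_le_log2 (R : realType) n : (0 < n)%N ->
  (trunc_log 2 n)%:R <= log2 n%:R :> R.
Proof.
move=> n0; have ln20 : 0 < ln 2 :> R by rewrite ln_gt0 // ltr1n.
rewrite /log2 ler_pdivlMr // mulr_natl -lnXn // ler_ln ?posrE ?exprn_gt0 ?ltr0n //.
by rewrite -natrX ler_nat trunc_logP.
Qed.

Lemma ordered_ramsey_exists k (G H : ordered_hypergraph k) M : ordered_arrow G H M ->
  exists2 N, is_ordered_ramsey G H N & (N <= M)%N.
Proof.
move=> arr; have ex : exists N, `[< ordered_arrow G H N >] by exists M; apply/asboolP.
case: (ex_minnP ex) => N /asboolP arrN minN; exists N; last by apply/minN/asboolP.
by split=> // M' arrM'; apply/minN/asboolP.
Qed.

Theorem theorem1p3 (R : realType) (s : nat) :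
  exists c : R, forall k n : nat, (3 <= k)%N -> (2 <= n)%N ->
    exists N : nat,
      is_ordered_ramsey (complete_hypergraph k s) (monotone_path k n) N /\
      N%:R <= twr (k - 2) (2 `^ (c * log2 n%:R ^ (s%:Z - 1))).
Proof.
(* With [t = s - 2], [j = k - 3], [e = T + 1] and [k <= s], the factors bound [t + 4],
   [(j + 4)! = (k + 1)!] and, by [e + 2 = T + 3 <= 4 * T], the power [(e + 2) ^ (s - 1)] up to
   [T ^ (s - 1)]. *)
pose C := ((s + 2) * (s.+1)`! * 4 ^ s.-1)%N.
(* The entry [s] of the maximum serves the case [s < k], where [s] vertices suffice. *)
exists (maxn s C)%:R => k n k3 n2.
have tl0 : (0 < trunc_log 2 n)%N by rewrite trunc_log_gt0.
set L := log2 n%:R.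
have tlL : (trunc_log 2 n)%:R <= L by apply: trunc_log_le_log2; lia.
have L1 : 1 <= L by apply: le_trans tlL; rewrite ler1n.
have Lpow : (0 < s)%N -> L ^ (s%:Z - 1) = L ^+ s.-1.
  by case: (s) => // s' _; rewrite subzn // subn1.
suff [M arr Mle] : exists2 M,
    ordered_arrow (complete_hypergraph k s) (monotone_path k n) M &
    M%:R <= twr (k - 2) (2 `^ ((maxn s C)%:R * L ^ (s%:Z - 1))).
  have [N ramN NM] := ordered_ramsey_exists arr; exists N; split=> //.
  by apply: le_trans Mle; rewrite ler_nat.
rewrite /twr; have -> : ((k - 2).-1 = k - 3)%N by lia.
have tower x : x%:R <= (maxn s C)%:R * L ^ (s%:Z - 1) ->
    (iter (k - 3) (expn 2) (2 ^ x)%N)%:R <=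
    iter (k - 3) (fun y : R => 2 `^ y) (2 `^ ((maxn s C)%:R * L ^ (s%:Z - 1))).
  move=> xle; rewrite natr_iter_exp2; apply: ler_iter_powR2.
  by rewrite natrX -powR_mulrn // ler_powR // ler1n.
have [sk|ks] := ltnP s k.
  exists s; first exact: ordered_arrow_trivial.
  (* For [s = 0] the exponent of [L] is -1, but the bound only has to be nonnegative. *)
  have [->|s0] := posnP s.
    by elim: (k - 3)%N => [|j _] /=; apply: powR_ge0.
  apply: le_trans (tower s _); last first.
    rewrite Lpow //; apply: (@le_trans _ _ (maxn s C)%:R); first by rewrite ler_nat leq_maxl.
    by rewrite ler_peMr // exprn_ege1.
  rewrite ler_nat; apply: leq_trans (iter_exp2_ge _ _).
  exact/ltnW/ltn_expl.
have [t st] : exists t, s = t.+2 by exists (s - 2)%N; lia.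
have [m nm] : exists m, n = m.+2 by exists (n - 2)%N; lia.
have [j kj] : exists j, k = (j + 3)%N by exists (k - 3)%N; lia.
set T := trunc_log 2 n in tl0 tlL.
have me : (m.+1 < 2 ^ T.+1)%N.
  by apply: leq_trans (trunc_log_ltn n (isT : 1 < 2)%N); rewrite nm.
have := @ordered_arrow_tower T.+1 t m j me.
rewrite -st -nm -kj => arr; eexists; first exact: arr.
have -> : j = (k - 3)%N by lia.
apply: tower; rewrite Lpow; last by lia.
apply: (@le_trans _ _ (C * T ^ s.-1)%:R).
  rewrite ler_nat /C -[leqRHS]mulnA -expnMn st /=.
  apply: leq_mul; first by apply: leq_mul; [lia|apply: leq_fact; lia].
  by rewrite leq_exp2r //; lia.
rewrite natrM natrX; apply: ler_pM => //.
  by rewrite ler_nat leq_maxr.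
by apply: lerXn2r; rewrite // nnegrE // (le_trans _ L1).
Qed.
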